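(* Let $p$ be a partial metric type on a set $X$ and let $T:X\to X$ be a self mapping such that, for some integer $n>1$ and some real $K$ with $0<K<1$, $$p(T^nx,T^ny)\leq K\,p(x,y)\quad\text{for all }x,y\in X.$$ Let $\lambda$ be a nonnegative real number such that $K^{1/n}<\frac{1}{\lambda}<1$, and let $p':X\times X\to[0,\infty)$ be the partial metric type defined by $$p'(x,y)=\sum_{i=0}^{n-1}\lambda^i\,p(T^ix,T^iy),\qquad x,y\in X.$$ If $T:(X,p)\to(X,p)$ is uniformly continuous and $(X,p)$ is $0$-complete, then $(X,p')$ is $0$-complete.
   Context: A partial metric type on a set $X$ is a function $p:X\times X\to[0,\infty)$ such that: (pm1) for all $x,y\in X$, $x=y$ if and only if $p(x,x)=p(x,y)=p(y,y)$; (pm2) $0\leq p(x,x)\leq p(x,y)$ for all $x,y\in X$; (pm3) $p(x,y)=p(y,x)$ for all $x,y\in X$; (pm4) there exists a real number $s\geq1$ such that $p(x,y)+p(z,z)\leq s[p(x,z)+p(z,y)]$ for all $x,y,z\in X$. Here $T^i$ denotes the $i$-th iterate of $T$, with $T^0$ the identity. A map $T:(X,p_1)\to(Y,p_2)$ between sets with partial metric types is uniformly continuous if for every $\varepsilon>0$ there exists $\delta>0$ such that for all $x,y\in X$ with $p_1(x,y)<\delta$ one has $p_2(Tx,Ty)<\varepsilon$. A sequence $(x_n)_{n\ge1}$ in $X$ is $0$-Cauchy (with respect to $p$) if $\lim_{n,m\to\infty}p(x_n,x_m)=0$. $(X,p)$ is $0$-complete if for every $0$-Cauchy sequence $(x_n)_{n\ge1}$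 in $X$ there exists $x\in X$ with $\lim_{n,m\to\infty}p(x_n,x_m)=\lim_{n\to\infty}p(x_n,x)=p(x,x)=0$. *)

(* Defs.v *)
From HB Require Import structures.
From mathcomp Require Import all_boot all_order all_algebra.
From mathcomp Require Import all_classical all_reals all_analysis.

Set Implicit Arguments.
Unset Strict Implicit.
Unset Printing Implicit Defensive.

Import Order.TTheory GRing.Theory Num.Theory.
Import numFieldNormedType.Exports.

Local Open Scope classical_set_scope.
Local Open Scope ring_scope.

Section PartialMetricType.
Context {R : realType}.

(* [pmt_ge0] encodes the codomain [0, +oo[. *)
Record is_partial_metric_type (X : Type) (p : X -> X -> R) : Prop := {
  pmt_ge0 : forall x y, 0 <= p x y ;
  pmt_eq : forall x y, x = y <-> (p x x = p x y /\ p x y = p y y) ;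
  pmt_self : forall x y, 0 <= p x x /\ p x x <= p x y ;
  pmt_sym : forall x y, p x y = p y x ;
  pmt_triangle : exists s : R, 1 <= s /\
    forall x y z, p x y + p z z <= s * (p x z + p z y) }.

(* Not the uniform continuity of uniform spaces: [p x x] may be nonzero. *)
Definition pmt_unif_continuous (X Y : Type) (p1 : X -> X -> R)
    (p2 : Y -> Y -> R) (T : X -> Y) : Prop :=
  forall eps : R, 0 < eps -> exists delta : R, 0 < delta /\
    forall x y, p1 x y < delta -> p2 (T x) (T y) < eps.

Definition zero_cauchy (X : Type) (p : X -> X -> R) (u : nat -> X) : Prop :=
  (fun nm : nat * nat => p (u nm.1) (u nm.2)) @ (\oo, \oo) --> (0 : R).

Definition zero_complete (X : Type) (p : X -> X -> R) : Prop :=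
  forall u : nat -> X, zero_cauchy p u ->
    exists x : X,
      [/\ (fun nm : nat * nat => p (u nm.1) (u nm.2)) @ (\oo, \oo) --> (0 : R),
          (fun n => p (u n) x) @ \oo --> (0 : R)
        & p x x = 0].

Definition iter_pmt (X : Type) (p : X -> X -> R) (T : X -> X) (n : nat)
    (lambda : R) : X -> X -> R :=
  fun x y => \sum_(i < n) lambda ^+ i * p (iter i T x) (iter i T y).

Lemma iter_pmt_is_partial_metric_type (X : Type) (p : X -> X -> R)
    (T : X -> X) (n : nat) (lambda : R) :
  is_partial_metric_type p -> (0 < n)%N -> 0 <= lambda ->
  is_partial_metric_type (iter_pmt p T n lambda).
Proof.
move=> [p0 peq pself psym [s [s1 ptri]]] n0 l0.
have l_ge0 i : 0 <= lambda ^+ i by exact: exprn_ge0.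
have self x y : iter_pmt p T n lambda x x <= iter_pmt p T n lambda x y.
  by apply: ler_sum => i _; apply: ler_wpM2l => //; case: (pself (iter i T x) (iter i T y)).
have ge0 x y : 0 <= iter_pmt p T n lambda x y.
  by apply: sumr_ge0 => i _; apply: mulr_ge0.
have sym x y : iter_pmt p T n lambda x y = iter_pmt p T n lambda y x.
  by apply: eq_bigr => i _; rewrite psym.
have head x y : iter_pmt p T n lambda x x = iter_pmt p T n lambda x y ->
    p x x = p x y.
  move=> h; apply/eqP; rewrite eq_le; case: (pself x y) => _ -> /=.
  move: h; rewrite /iter_pmt; case: n n0 {self ge0 sym} => // m _.
  rewrite !big_ord_recl !expr0 !mul1r /= => h.
  rewrite -(lerD2r (\sum_(i < m) lambda ^+ lift ord0 i *
    p (iter (lift ord0 i) T x) (iter (lift ord0 i) T x))) h lerD2l.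
  by apply: ler_sum => i _; apply: ler_wpM2l => //; case: (pself (iter (lift ord0 i) T x) (iter (lift ord0 i) T y)).
split=> //.
- move=> x y; split=> [->//|[h1 h2]]; apply/peq; split; first exact: head.
  by rewrite psym; apply/esym/head; rewrite -h2 sym.
- exists s; split=> // x y z; rewrite /iter_pmt -!big_split mulr_sumr /=.
  by apply: ler_sum => i _; rewrite -!mulrDr mulrCA; apply: ler_wpM2l.
Qed.

End PartialMetricType.

(* Main.v *)
Require Import Defs.
From mathcomp Require Import all_boot all_order all_algebra.
From mathcomp Require Import all_classical all_reals all_analysis.

Import Order.TTheory GRing.Theory Num.Theory.
Import numFieldNormedType.Exports.

Local Open Scope classical_set_scope.
Local Open Scope ring_scope.

(** The identity of X is uniformly continuous from p' to p because p is the term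
    i = 0 of p', so a 0-Cauchy sequence u for p' has a 0-limit x for p. Uniform
    continuity of the iterates of T then gives p (T^i (u k)) (T^i x) --> 0, and
    also p (T^i x) (T^i x) = 0 since p x x = 0; the finite sum defining p'
    inherits both. *)

Lemma pmt_unif_continuous_iter {R : realType} {X : Type} {p : X -> X -> R}
    {T : X -> X} (i : nat) :
  pmt_unif_continuous p p T -> pmt_unif_continuous p p (iter i T).
Proof.
move=> Tu; elim: i => [|i IHi] eps eps0; first by exists eps.
have [d [d0 Td]] := Tu _ eps0; have [c [c0 Tc]] := IHi _ d0.
by exists c; split=> // x y /Tc /Td.
Qed.

(** The filter [F] is left arbitrary so that one statement covers both the double limit over pairs
    of indices in the Cauchy condition and the simple limit of [p (u n) x]. *)
Lemma pmt_unif_continuous_cvg0 {R : realType} {X Y I : Type}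
    {p : X -> X -> R} {q : Y -> Y -> R} {S : X -> Y}
    {F : set_system I} {FF : Filter F} {f g : I -> X} :
  (forall x y, 0 <= p x y) -> (forall x y, 0 <= q x y) ->
  pmt_unif_continuous p q S ->
  (fun k => p (f k) (g k)) @ F --> (0 : R) ->
  (fun k => q (S (f k)) (S (g k))) @ F --> (0 : R).
Proof.
move=> p0 q0 Su /cvgrPdist_lt pfg; apply/cvgrPdist_lt => eps eps0.
have [d [d0 Sd]] := Su _ eps0.
apply: filterS (pfg _ d0) => k.
by rewrite !sub0r !normrN !ger0_norm //; exact: Sd.
Qed.

(** A zero distance lies below every [delta], so the image distance lies below every positive
    [eps]. *)
Lemma pmt_unif_continuous_eq0 {R : realType} {X Y : Type}
    {p : X -> X -> R} {q : Y -> Y -> R} {S : X -> Y} {x y : X} :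
  (forall x y, 0 <= q x y) -> pmt_unif_continuous p q S ->
  p x y = 0 -> q (S x) (S y) = 0.
Proof.
move=> q0 Su pxy; apply/eqP; rewrite eq_le q0 andbT.
apply/ler_addgt0Pr => eps eps0; rewrite add0r.
by have [d [d0 Sd]] := Su _ eps0; apply/ltW/Sd; rewrite pxy.
Qed.

Lemma le_iter_pmt (R : realType) (X : Type) (p : X -> X -> R) (T : X -> X)
    (n : nat) (lambda : R) (x y : X) :
  (forall x y, 0 <= p x y) -> (0 < n)%N -> 0 <= lambda ->
  p x y <= iter_pmt p T n lambda x y.
Proof.
move=> p0; case: n => // n _ l0.
rewrite /iter_pmt big_ord_recl expr0 mul1r lerDl.
by apply: sumr_ge0 => i _; rewrite mulr_ge0 ?exprn_ge0.
Qed.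

Theorem theorem2p6 (R : realType) (X : Type) (p : X -> X -> R) (T : X -> X)
    (n : nat) (K lambda : R)
    (p_pmt : is_partial_metric_type p)
    (n_gt1 : (1 < n)%N) (K_gt0 : 0 < K) (K_lt1 : K < 1)
    (T_contr : forall x y : X, p (iter n T x) (iter n T y) <= K * p x y)
    (lambda_ge0 : 0 <= lambda)
    (K_lambda : K `^ (n%:R^-1) < 1 / lambda) (lambda_lt : 1 / lambda < 1)
    (T_unif : pmt_unif_continuous p p T)
    (p_complete : zero_complete p) :
  zero_complete (iter_pmt p T n lambda).
Proof.
have p0 := pmt_ge0 p_pmt.
have n_gt0 : (0 < n)%N by exact: ltnW.
have p'0 := pmt_ge0 (iter_pmt_is_partial_metric_type T p_pmt n_gt0 lambda_ge0).
have Ti i := pmt_unif_continuous_iter i T_unif.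
have id_unif : pmt_unif_continuous (iter_pmt p T n lambda) p id.
  move=> eps eps0; exists eps; split=> // x y; apply: le_lt_trans.
  exact: le_iter_pmt.
move=> u p'u; have pu : zero_cauchy p u.
  exact: (pmt_unif_continuous_cvg0 p'0 p0 id_unif p'u).
have [x [_ ux xx]] := p_complete u pu.
(* The double limit is the hypothesis [p'u] itself; the self-distance of [x] comes first, then the
   convergence to [x]. *)
exists x; split=> //; last first.
  by apply: big1 => i _; rewrite (pmt_unif_continuous_eq0 p0 (Ti i) xx) mulr0.
(* Writing the limit as a sum of the same shape as [iter_pmt] lets the convergence be checked term
   by term. *)
have -> : (0 : R) = \sum_(i < n) lambda ^+ i * 0.
  by rewrite big1 // => i _; rewrite mulr0.
apply: cvg_big => [|i _]; first exact: add_continuous.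
apply: cvgMl_tmp.
exact: (pmt_unif_continuous_cvg0 p0 p0 (Ti i) ux).
Qed.
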